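(* Let $I\subseteq\mathbb{R}$ be a nonempty open interval, let $F:I\to\mathbb{R}$ be affine on $I$, and let $g_1,g_2:I\to\mathbb{R}$ be continuous and strictly monotone. Let $f_1,f_2:I\to\mathbb{R}$ and $G:g_1(I)+g_2(I)\to\mathbb{R}$ be functions. Then $$F\Big(\frac{x+y}{2}\Big)+f_1(x)+f_2(y)=G\big(g_1(x)+g_2(y)\big)\qquad\text{for all }x,y\in I$$ if and only if there exist an additive function $B:\mathbb{R}\to\mathbb{R}$ and constants $\beta_1,\beta_2\in\mathbb{R}$ such that $$f_k(x)=-\tfrac12F(x)+B(g_k(x))+\beta_k\quad(x\in I,\ k=1,2)\qquad\text{and}\qquad G(u)=B(u)+\beta\quad(u\in g_1(I)+g_2(I)),$$ where $\beta=\beta_1+\beta_2$.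
   Context: A function $B:\mathbb{R}\to\mathbb{R}$ is additive if $B(s+t)=B(s)+B(t)$ for all $s,t\in\mathbb{R}$. A function $h:I\to\mathbb{R}$ is affine on a nonempty open subinterval $U\subseteq I$ if there exist an additive function $A:\mathbb{R}\to\mathbb{R}$ and $b\in\mathbb{R}$ with $h(x)=A(x)+b$ for all $x\in U$ (no continuity of $A$ is required). For sets $S,T\subseteq\mathbb{R}$, $S+T=\{s+t: s\in S,\ t\in T\}$. *)

(* Defs.v *)
From HB Require Import structures.
From mathcomp Require Import all_boot all_order all_algebra.
From mathcomp Require Import all_classical all_reals all_analysis.
Import Order.TTheory GRing.Theory Num.Theory.
Import numFieldNormedType.Exports.

Set Implicit Arguments.
Unset Strict Implicit.
Unset Printing Implicit Defensive.

Local Open Scope classical_set_scope.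
Local Open Scope ring_scope.

(* A real function on I is encoded as a total function R -> R of which only
   the values on I matter. *)

Definition additive_fun (R : realType) (B : R -> R) : Prop :=
  {morph B : s t / s + t}.

Definition affine_on (R : realType) (U : set R) (h : R -> R) : Prop :=
  exists (A : R -> R) (b : R),
    additive_fun A /\ forall x, U x -> h x = A x + b.

Definition set_sum (R : realType) (S T : set R) : set R :=
  [set s + t | s in S & t in T].

(* Main.v *)
Require Import Defs.
From mathcomp Require Import all_boot all_order all_algebra.
From mathcomp Require Import unstable all_classical all_reals all_analysis.
From mathcomp Require Import ring lra.
Import Order.TTheory GRing.Theory Num.Theory.
Import numFieldNormedType.Exports.

Set Implicit Arguments.
Unset Strict Implicit.
Unset Printing Implicit Defensive.

Local Open Scope classical_set_scope.
Local Open Scope ring_scope.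

(** The function [F] enters only through the midpoint identity
    [F ((x + y) / 2) = F x / 2 + F y / 2], which every affine function
    satisfies.  With [h1 := f1 + F / 2] and [h2 := f2 + F / 2] the equation
    becomes the Pexider equation [h1 x + h2 y = G (g1 x + g2 y)], in which
    [x] and [y] are independent.

    The images [g1 @` I] and [g2 @` I] are open intervals, because [g1] and
    [g2] are continuous and strictly monotone ([open_image_strict_monotonic]).
    Fix a base point of each and let [r] be the increment of [G] from the sum
    of the two base points.  On the two images, translated to contain [0], [r]
    gives the increments of [h1] and of [h2], so that [r] satisfies Cauchy's
    equation [r (s + t) = r s + r t] for [s] in the first translated interval
    and [t] in the second.

    Such an [r] is the restriction of an additive function on the whole line
    ([cauchy_extension]): near [0] the equation forces [r x = n * r (x / n)],
    so that [n * r (x / n)], for [n] large, defines the extension at every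
    real [x].  That the extension agrees with [r] on all of both intervals, and
    not just near [0], follows by walking from [0] to [s] in [n] equal steps,
    small enough to lie in the other interval ([cauchy_scale]).  Undoing the
    translation turns the base values into the constants [beta1] and
    [beta2]. *)

(** * Cauchy's equation on a product of two intervals *)

Lemma is_interval_scale (R : realType) (S : set R) (l s : R) :
  is_interval S -> S 0 -> S s -> 0 <= l <= 1 -> S (l * s).
Proof.
move=> S_itv S0 Ss /andP[l0 l1].
have [s0|/ltW s0] := leP 0 s.
  by apply: (S_itv 0 s) => //; rewrite mulr_ge0 //= ler_piMl.
by apply: (S_itv s 0) => //; rewrite mulr_ge0_le0 // andbT ler_niMl.
Qed.

(** All the points [k * (s / n)] of the walk from [0] to [s] lie in [S], and
    each step is in [T]. *)
Lemma cauchy_scale (R : realType) (S T : set R) (r : R -> R) (s : R) (n : nat) :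
  is_interval S -> S 0 -> T 0 ->
  (forall u v, S u -> T v -> r (u + v) = r u + r v) ->
  S s -> T (s / n.+1%:R) -> r s = n.+1%:R * r (s / n.+1%:R).
Proof.
move=> S_itv S0 T0 rD Ss Tsn.
have r0 : r 0 = 0 by have := rD 0 0 S0 T0; rewrite addr0; lra.
have walk k : (k <= n.+1)%N ->
    r (k%:R * (s / n.+1%:R)) = k%:R * r (s / n.+1%:R).
  elim: k => [|k IH] kn; first by rewrite !mul0r.
  rewrite -natr1 !mulrDl !mul1r rD ?IH ?(ltnW kn) //.
  rewrite mulrCA mulrC; apply: is_interval_scale => //.
  by rewrite divr_ge0 //= ler_pdivrMr // mul1r ler_nat ltnW.
by rewrite -walk // mulrC divfK.
Qed.

(** Additivity of the extension is read off from a common denominator [n] for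
    [s], [t] and [s + t]; a common multiple of two denominators shows that the
    value does not depend on the choice. *)
Lemma cauchy_extension (R : realType) (S T : set R) (r : R -> R) :
  is_interval S -> is_interval T -> nbhs 0 S -> nbhs 0 T ->
  (forall s t, S s -> T t -> r (s + t) = r s + r t) ->
  exists B : R -> R, [/\ additive_fun B,
    forall s, S s -> r s = B s & forall t, T t -> r t = B t].
Proof.
move=> S_itv T_itv nS nT rD.
have S0 : S 0 := nbhs_singleton nS.
have T0 : T 0 := nbhs_singleton nT.
have rD' s t : T s -> S t -> r (s + t) = r s + r t.
  by move=> Ts St; rewrite addrC rD // addrC.
have /nbhs_ballP[e /= e0 eST] : nbhs 0 (S `&` T) by exact: filterI.
have small (x : R) : `|x| < e -> S x /\ T x.
  by move=> xe; apply: eST; rewrite /ball /= sub0r normrN.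
have smallV (x : R) n : `|x| < n.+1%:R * e -> `|x / n.+1%:R| < e.
  by rewrite normrM normfV [`|n.+1%:R|]ger0_norm // ltr_pdivrMr // mulrC.
have scaleS x n : S x -> `|x| < n.+1%:R * e -> r x = n.+1%:R * r (x / n.+1%:R).
  move=> Sx /smallV/small[_ Tx].
  exact: (@cauchy_scale R S T).
have scaleT x n : T x -> `|x| < n.+1%:R * e -> r x = n.+1%:R * r (x / n.+1%:R).
  move=> Tx /smallV/small[Sx _].
  exact: (@cauchy_scale R T S).
have indep (x : R) n m : `|x| < n.+1%:R * e -> `|x| < m.+1%:R * e ->
    n.+1%:R * r (x / n.+1%:R) = m.+1%:R * r (x / m.+1%:R).
  have half p q : `|x| < p.+1%:R * e ->
      p.+1%:R * r (x / p.+1%:R)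
      = p.+1%:R * q.+1%:R * r (x / (p.+1%:R * q.+1%:R)).
    move=> xp; have xpe := smallV _ _ xp; have [Sxp _] := small _ xpe.
    rewrite -mulrA invfM [x * (_ * _)]mulrA -(scaleS _ q Sxp) //.
    by rewrite (lt_le_trans xpe) // ler_peMl ?ler1n // ltW.
  by move=> xn xm; rewrite (half n m) // (half m n) // [m.+1%:R * _]mulrC.
pose N (x : R) := Num.truncn (`|x| / e).
have NP x : `|x| < (N x).+1%:R * e.
  by rewrite -ltr_pdivrMr // truncnS_gt.
pose B x := (N x).+1%:R * r (x / (N x).+1%:R).
have BE x n : `|x| < n.+1%:R * e -> B x = n.+1%:R * r (x / n.+1%:R).
  by move=> xn; apply: indep.
exists B; split=> [s t|s Ss|t Tt]; [|exact: scaleS|exact: scaleT].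
set n := N (`|s| + `|t|).
have := NP (`|s| + `|t|); rewrite -/n ger0_norm ?addr_ge0 // => stn.
have sn : `|s| < n.+1%:R * e by rewrite (le_lt_trans _ stn) // lerDl.
have tn : `|t| < n.+1%:R * e by rewrite (le_lt_trans _ stn) // lerDr.
rewrite (BE s n) // (BE t n) // (BE (s + t) n); last first.
  by rewrite (le_lt_trans _ stn) // ler_normD.
have [Ssn _] := small _ (smallV _ _ sn).
have [_ Ttn] := small _ (smallV _ _ tn).
by rewrite mulrDl rD // mulrDr.
Qed.

(** * Pexider's equation *)

Lemma is_interval_shift (R : realType) (S : set R) (a : R) :
  is_interval S -> is_interval [set s | S (a + s)].
Proof.
move=> S_itv x y /= Sx Sy z /andP[xz zy].
by apply: (S_itv _ _ Sx Sy); rewrite !lerD2l xz zy.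
Qed.

Lemma nbhs_shift (R : realType) (S : set R) (a : R) :
  nbhs a S -> nbhs 0 [set s | S (a + s)].
Proof.
move=> /nbhs_ballP[e e0 eS]; apply/nbhs_ballP; exists e => // s.
rewrite /ball /= sub0r normrN => se.
by apply: eS; rewrite /ball /= opprD addrA subrr sub0r normrN.
Qed.

(** Only [G] is used to define the increment function, so [h1] and [h2] need
    not be known in advance to factor through [g1] and [g2]. *)
Lemma pexider (R : realType) (T1 T2 : Type) (X : set T1) (Y : set T2)
    (g1 h1 : T1 -> R) (g2 h2 : T2 -> R) (G : R -> R) :
  X !=set0 -> Y !=set0 ->
  open (g1 @` X) -> is_interval (g1 @` X) ->
  open (g2 @` Y) -> is_interval (g2 @` Y) ->
  (forall x y, X x -> Y y -> h1 x + h2 y = G (g1 x + g2 y)) ->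
  exists (B : R -> R) (beta1 beta2 : R),
    [/\ additive_fun B,
        forall x, X x -> h1 x = B (g1 x) + beta1,
        forall y, Y y -> h2 y = B (g2 y) + beta2
      & forall u, set_sum (g1 @` X) (g2 @` Y) u -> G u = B u + (beta1 + beta2)].
Proof.
move=> [x0 Xx0] [y0 Yy0] open1 itv1 open2 itv2 hG.
set a := g1 x0; set c := g2 y0.
pose r w := G (a + c + w) - G (a + c).
have rX x : X x -> r (g1 x - a) = h1 x - h1 x0.
  move=> Xx; rewrite /r (_ : a + c + (g1 x - a) = g1 x + c); last by ring.
  by rewrite -!hG //; ring.
have rY y : Y y -> r (g2 y - c) = h2 y - h2 y0.
  move=> Yy; rewrite /r (_ : a + c + (g2 y - c) = a + g2 y); last by ring.
  by rewrite -!hG //; ring.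
have rXY x y : X x -> Y y ->
    r ((g1 x - a) + (g2 y - c)) = r (g1 x - a) + r (g2 y - c).
  move=> Xx Yy; rewrite rX // rY // /r.
  rewrite (_ : a + c + _ = g1 x + g2 y); last by ring.
  by rewrite -!hG //; ring.
have nbhs1 : nbhs a (g1 @` X) by apply: open_nbhs_nbhs; split=> //; exists x0.
have nbhs2 : nbhs c (g2 @` Y) by apply: open_nbhs_nbhs; split=> //; exists y0.
have [s t /= [x Xx xs] [y Yy yt]|B [BD BX BY]] := cauchy_extension
    (is_interval_shift (a := a) itv1) (is_interval_shift (a := c) itv2)
    (nbhs_shift nbhs1) (nbhs_shift nbhs2) (r := r).
  have -> : s = g1 x - a by rewrite xs; ring.
  have -> : t = g2 y - c by rewrite yt; ring.
  exact: rXY.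
have BB u v : B (u - v) = B u - B v.
  by have := BD (u - v) v; rewrite subrK => ->; rewrite addrK.
have h1E x : X x -> h1 x = B (g1 x) + (h1 x0 - B a).
  move=> Xx; have := rX x Xx; rewrite BX ?BB; first lra.
  by exists x => //; ring.
have h2E y : Y y -> h2 y = B (g2 y) + (h2 y0 - B c).
  move=> Yy; have := rY y Yy; rewrite BY ?BB; first lra.
  by exists y => //; ring.
exists B, (h1 x0 - B a), (h2 y0 - B c); split=> //.
move=> _ [_ [x Xx <-] [_ [y Yy <-] <-]].
by rewrite -hG // h1E // h2E // BD; ring.
Qed.

(** * Images of intervals under continuous strictly monotone functions *)

Lemma is_interval_image (R : realType) (I : set R) (g : R -> R) :
  is_interval I -> {within I, continuous g} -> is_interval (g @` I).
Proof.
move=> I_itv g_cont; apply/connected_intervalP.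
by apply: connected_continuous_connected => //; apply/connected_intervalP.
Qed.

(** Two points of [I] on either side of [x] have images on either side of
    [g x], and the image, being an interval, contains everything between. *)
Lemma open_image_strict_monotonic (R : realType) (I : set R) (g : R -> R) :
  open I -> is_interval I -> {within I, continuous g} ->
  strict_monotonic I g -> open (g @` I).
Proof.
move=> I_open I_itv g_cont g_mono.
have gI_itv := is_interval_image I_itv g_cont.
rewrite openE => _ [x Ix <-].
have /nbhs_ballP[e /= e0 eI] : nbhs x I by apply: open_nbhs_nbhs.
have Il : I (x - e / 2) by apply: eI; rewrite /ball /= ltr_norml; lra.
have Ir : I (x + e / 2) by apply: eI; rewrite /ball /= ltr_norml; lra.
have between p q : (g @` I) p -> (g @` I) q -> p < g x < q ->
    nbhs (g x) (g @` I).
  move=> gp gq pxq.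
  apply: filterS (near_in_itvoo (x := g x) (a := p) (b := q) _).
    move=> z /=; rewrite in_itv /= => /andP[pz zq].
    by apply: (gI_itv p q) => //; rewrite !ltW.
  by rewrite in_itv.
have gl : (g @` I) (g (x - e / 2)) by exists (x - e / 2).
have gr : (g @` I) (g (x + e / 2)) by exists (x + e / 2).
have [lx xr] : x - e / 2 < x /\ x < x + e / 2 by lra.
case: g_mono => g_mono.
  by apply: (between _ _ gl gr); rewrite !g_mono //; apply: mem_set.
by apply: (between _ _ gr gl); rewrite !g_mono //; apply: mem_set.
Qed.

(** * The functional equation *)

Lemma affine_on_midpoint (R : realType) (I : set R) (F : R -> R) (x y : R) :
  is_interval I -> affine_on I F -> I x -> I y ->
  F ((x + y) / 2) = F x / 2 + F y / 2.
Proof.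
move=> I_itv [A [b [AD FE]]] Ix Iy.
have Ixy : I ((x + y) / 2).
  have [xy|/ltW yx] := leP x y.
    by apply: (I_itv x y) => //; apply/andP; split; lra.
  by apply: (I_itv y x) => //; apply/andP; split; lra.
have A2 u : A u = A (u / 2) + A (u / 2) by rewrite -AD -splitr.
rewrite !FE //; have := A2 (x + y); rewrite AD; lra.
Qed.

Theorem theorem2 (R : realType) (I : set R)
    (I_neq0 : I !=set0) (I_open : open I) (I_itv : is_interval I)
    (F : R -> R) (F_affine : affine_on I F)
    (g1 g2 : R -> R)
    (g1_cont : {within I, continuous g1}) (g2_cont : {within I, continuous g2})
    (g1_mono : strict_monotonic I g1) (g2_mono : strict_monotonic I g2)
    (f1 f2 G : R -> R) :
  (forall x y : R, I x -> I y ->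
     F ((x + y) / 2) + f1 x + f2 y = G (g1 x + g2 y))
  <->
  (exists (B : R -> R) (beta1 beta2 : R),
     [/\ additive_fun B,
         forall x : R, I x -> f1 x = - (1 / 2) * F x + B (g1 x) + beta1,
         forall x : R, I x -> f2 x = - (1 / 2) * F x + B (g2 x) + beta2
       & forall u : R, set_sum (g1 @` I) (g2 @` I) u ->
           G u = B u + (beta1 + beta2)]).
Proof.
split=> [eqG|[B [beta1 [beta2 [BD f1E f2E GE]]]] x y Ix Iy]; last first.
  rewrite (affine_on_midpoint _ F_affine) // f1E // f2E // GE ?BD; first lra.
  by exists (g1 x); [exists x|exists (g2 y); [exists y|]].
have [x y Ix Iy|B [beta1 [beta2 [BD h1E h2E GE]]]] :=
    @pexider R R R I I g1 (fun x => f1 x + F x / 2) g2 (fun x => f2 x + F x / 2)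
      G I_neq0 I_neq0
      (open_image_strict_monotonic I_open I_itv g1_cont g1_mono)
      (is_interval_image I_itv g1_cont)
      (open_image_strict_monotonic I_open I_itv g2_cont g2_mono)
      (is_interval_image I_itv g2_cont).
  by rewrite -eqG // (affine_on_midpoint _ F_affine) //; ring.
exists B, beta1, beta2; split=> // x Ix.
  by have := h1E x Ix; lra.
by have := h2E x Ix; lra.
Qed.
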